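(* Let $\phi:[0,1]\to[0,1]$ be concave, $\phi(0)=0$, $\phi(1)=1$, continuous at $0$, and suppose its right derivative $\phi'(0)$ at $0$ is finite. Then there exists a constant $K$ such that $\|X\|_{\Lambda_\phi}\le K\|X\|_{M_\phi}$ for all $X\in M_\phi$; consequently $\Lambda_\phi=M_\phi$ and all ri norms with fundamental function $\phi$ are equivalent. Moreover $K=1/\phi(1/\phi'(0))$ is a feasible constant.
   Context: $\Omega=[0,1]$ with Lebesgue measure $\mu$. $X^*(\omega)=\inf\{\lambda\ge0:\mu\{|X|>\lambda\}\le\omega\}$. Lorentz norm $\|X\|_{\Lambda_\phi}=\int_0^1X^*(\omega)\phi'(\omega)\,d\omega$ (for $\phi$ continuous at $0$); Marcinkiewicz norm $\|X\|_{M_\phi}=\sup_{0<t\le1}\frac{\phi(t)}{t}\int_0^tX^*\,d\omega$; $\Lambda_\phi$, $M_\phi$ denote the spaces of measurable $X$ for which these norms are finite. An ri norm is $X\mapsto R(|X|)$ for a rearrangement invariant Banach function norm $R$ on nonnegative measurable functions (positive, homogeneous, subadditive, monotone, Fatou, $R(\chi_E)<\infty$, $\int_EX\le c_ER(X)$, $R(\chi_\Omega)=1$); its fundamental function is $t\mapsto R(\chi_E)$, $\mu(E)=t$. Two norms are equivalent if they define the same space and there are $c_1,c_2>0$ with $c_1\|X\|_1\le\|X\|_2\le c_2\|X\|_1$ on it. *)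

(* Defs.v *)
From HB Require Import structures.
From mathcomp Require Import all_boot all_order all_algebra.
From mathcomp Require Import all_classical all_reals all_analysis.
Set Implicit Arguments. Unset Strict Implicit. Unset Printing Implicit Defensive.
Import Order.TTheory GRing.Theory Num.Theory.
Import numFieldNormedType.Exports.
Local Open Scope classical_set_scope.
Local Open Scope ring_scope.

(* Omega = [0,1] with Lebesgue measure; random variables are functions R -> R
   of which only the restriction to [0,1] matters. *)
Definition Omega (R : realType) : set R := `[0%R, 1%R]%classic.
Arguments Omega R : clear implicits.

Notation leb := (@lebesgue_measure _).

Definition distf (R : realType) (X : R -> R) (l : R) : \bar R :=
  lebesgue_measure (Omega R `&` [set w | l < `|X w|]).

Definition rearr (R : realType) (X : R -> R) (w : R) : \bar R :=
  ereal_inf [set l%:E | l in [set l : R | 0 <= l /\ (distf X l <= w%:E)%E]].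

(* Lorentz norm  int_0^1 X^* phi'  (phi' = derivative, defined a.e.) *)
Definition LorentzNorm (R : realType) (phi : R -> R) (X : R -> R) : \bar R :=
  (\int[lebesgue_measure]_(w in Omega R) (rearr X w * (derive1 phi w)%:E))%E.

Definition MarcNorm (R : realType) (phi : R -> R) (X : R -> R) : \bar R :=
  ereal_sup [set ((phi t / t)%:E *
                  \int[lebesgue_measure]_(w in `[0%R, t]) rearr X w)%E
            | t in `]0%R, 1%R]%classic].

Definition LorentzSpace (R : realType) (phi : R -> R) : set (R -> R) :=
  [set X | measurable_fun (Omega R) X /\ (LorentzNorm phi X < +oo)%E].

Definition MarcSpace (R : realType) (phi : R -> R) : set (R -> R) :=
  [set X | measurable_fun (Omega R) X /\ (MarcNorm phi X < +oo)%E].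

Definition concave01 (R : realType) (phi : R -> R) : Prop :=
  forall x y t : R, Omega R x -> Omega R y -> 0 <= t <= 1 ->
    t * phi x + (1 - t) * phi y <= phi (t * x + (1 - t) * y).

Definition nnmeas (R : realType) (X : R -> R) : Prop :=
  measurable_fun (Omega R) X /\ forall w, Omega R w -> 0 <= X w.

Definition ri_bfn (R : realType) (Rn : (R -> R) -> \bar R) : Prop :=
      (forall X, nnmeas X ->
         (0 <= Rn X)%E /\
         (Rn X = 0%E <-> {ae lebesgue_measure, forall w, Omega R w -> X w = 0})
)
   /\
      (forall X c, nnmeas X -> 0 <= c -> Rn (fun w => c * X w) = (c%:E * Rn X)%E
)
   /\
      (forall X Y, nnmeas X -> nnmeas Y ->
         (Rn (fun w => (X w + Y w)%R) <= Rn X + Rn Y)%E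
)
   /\
      (forall X Y, nnmeas X -> nnmeas Y ->
         {ae lebesgue_measure, forall w, Omega R w -> X w <= Y w} ->
         (Rn X <= Rn Y)%E
)
   /\
      (forall (Xn : nat -> R -> R) X, (forall n, nnmeas (Xn n)) -> nnmeas X ->
         {ae lebesgue_measure, forall w, Omega R w ->
            {homo (fun n => Xn n w) : m n / (m <= n)%N >-> m <= n} /\
            Xn n w @[n --> \oo] --> X w} ->
         Rn (Xn n) @[n --> \oo] --> Rn X
)
   /\ (forall E, measurable E -> E `<=` Omega R -> (Rn (\1_E : R -> R) < +oo)%E
)
   /\ (forall E, measurable E -> E `<=` Omega R -> exists c : R,
         forall X, nnmeas X ->
           (\int[lebesgue_measure]_(w in E) (X w)%:E <= c%:E * Rn X)%E
)
   /\ Rn (\1_(Omega R) : R -> R) = 1%E /\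
      (forall X Y, nnmeas X -> nnmeas Y ->
         (forall l, lebesgue_measure (Omega R `&` [set w | l < X w]) =
                    lebesgue_measure (Omega R `&` [set w | l < Y w])) ->
         Rn X = Rn Y).

Definition has_fundamental (R : realType) (Rn : (R -> R) -> \bar R)
    (phi : R -> R) : Prop :=
  forall E, measurable E -> E `<=` Omega R ->
    Rn (\1_E : R -> R) = (phi (fine (lebesgue_measure E)))%:E.

Definition ri_norm_of (R : realType) (Rn : (R -> R) -> \bar R) (X : R -> R)
  : \bar R := Rn (fun w => `|X w|).

Definition equiv_norms (R : realType) (N1 N2 : (R -> R) -> \bar R) : Prop :=
  (forall X, measurable_fun (Omega R) X -> ((N1 X < +oo)%E <-> (N2 X < +oo)%E)) /\
  exists c1 c2 : R, 0 < c1 /\ 0 < c2 /\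
    forall X, measurable_fun (Omega R) X -> (N1 X < +oo)%E ->
      (c1%:E * N1 X <= N2 X)%E /\ (N2 X <= c2%:E * N1 X)%E.

(* Main.v *)
(**
The finite slope d at 0 forces t <= phi t <= d t, so every norm involved is
comparable with the L^1 norm.

For the constant, put a = 1/d and c = X^*(a).  As phi' takes values in [0, d]
and X^* is nonincreasing, X^* phi' + d c 1_[0,a] <= d X^* 1_[0,a] + c phi'.
Since d a = 1 and the integral of phi' is at most 1, integrating gives
||X||_Lambda <= d \int_0^a X^*, which is 1/phi(a) times the term t = a of the
supremum defining ||X||_M.

The derivative phi' is handled through supergradients: the points carrying two
of them are countably many (a rational strictly between two supergradients at x
determines x), and elsewhere phi' is the unique one.

For a rearrangement invariant norm R, the bound \int X <= c R(X) is an axiom,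
and R(X) <= d \int X follows from R(1_E) = phi(mu E) <= d mu(E) by
subadditivity and the Fatou property.
*)

Require Import Defs.
From HB Require Import structures.
From mathcomp Require Import all_boot all_order all_algebra.
From mathcomp Require Import all_classical all_reals all_analysis.
From mathcomp Require Import ring lra measurable_realfun.
Import Order.TTheory GRing.Theory Num.Theory.
Import numFieldNormedType.Exports.
Local Open Scope classical_set_scope.
Local Open Scope ring_scope.

(** * Measurability of monotone functions and of the rearrangement *)

(** A superlevel set of [f] is the trace on [D] of a set closed downwards, namely the points lying
    left of some point of [D] where [f] exceeds the level. Such a set is an interval even when [D]
    is not, which allows [D] to be [0,1] with countably many points removed. *)
Lemma nonincreasing_on_measurable {R : realType} (D : set R) (f : R -> \bar R) :
  measurable D -> (forall x y, D x -> D y -> x <= y -> (f y <= f x)%E) ->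
  measurable_fun D f.
Proof.
move=> mD f_ni.
apply: (measurability (@ErealGenOInfty.G R)).
  exact: ErealGenOInfty.measurableE.
move=> /= _ [_] [r ->] <-.
rewrite (_ : _ `&` _ = D `&` [set x | exists z, [/\ D z, x <= z & (r%:E < f z)%E]]).
  apply: measurableI => //; apply: is_interval_measurable => s t/=.
  move=> _ [z [Dz tz rz]] u /andP[su ut].
  by exists z; split => //; exact: le_trans tz.
apply/seteqP; split => x /= [Dx].
  by rewrite in_itv/= andbT => fx; split => //; exists x.
move=> [z [Dz xz rz]]; split => //; rewrite in_itv/= andbT.
exact: lt_le_trans (f_ni _ _ Dx Dz xz).
Qed.

Lemma rearr_ge0 {R : realType} (X : R -> R) (w : R) : (0 <= rearr X w)%E.
Proof. by apply: le_ereal_inf_tmp => _ [l [l0 _] <-]; rewrite lee_fin. Qed.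

Lemma rearr_nonincreasing {R : realType} (X : R -> R) (x y : R) :
  x <= y -> (rearr X y <= rearr X x)%E.
Proof.
move=> xy; apply: ereal_inf_le_tmp => _ [l [l0 hl] <-].
by exists l => //; split => //; apply: le_trans hl _; rewrite lee_fin.
Qed.

Lemma measurable_rearr {R : realType} (X : R -> R) (D : set R) :
  measurable D -> measurable_fun D (rearr X).
Proof.
move=> mD; apply: nonincreasing_on_measurable => // x y _ _.
exact: rearr_nonincreasing.
Qed.

(** * Chords, supergradients and differentiability of concave functions *)

Lemma OmegaE {R : realType} (x : R) : Omega R x <-> 0 <= x <= 1.
Proof. by rewrite /Omega/= in_itv. Qed.

Lemma concave01_chord {R : realType} (phi : R -> R) (x y z : R) :
  concave01 phi -> 0 <= x -> x < y -> y < z -> z <= 1 ->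
  (phi z - phi y) / (z - y) <= (phi y - phi x) / (y - x).
Proof.
move=> hc x0 xy yz z1.
have xz : 0 < z - x by lra.
have Ox : Omega R x by apply/OmegaE; lra.
have Oz : Omega R z by apply/OmegaE; lra.
have ht : 0 <= (z - y) / (z - x) <= 1.
  by rewrite divr_ge0 ?ler_pdivrMr ?mul1r//=; lra.
have := hc x z _ Ox Oz ht.
rewrite (_ : _ * x + _ = y); last by field; lra.
rewrite -(ler_pM2r xz) (_ : _ * (z - x) = (z - y) * phi x + (y - x) * phi z);
  last by field; lra.
move=> h.
rewrite ler_pdivrMr ?subr_gt0// mulrAC ler_pdivlMr ?subr_gt0//.
lra.
Qed.

Definition supergrad {R : realType} (phi : R -> R) (x s : R) :=
  forall y, Omega R y -> phi y <= phi x + s * (y - x).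

(** The slopes of chords issued from [x] decrease from left to right, so the supremum [sup A] of the
    right slopes is at most the infimum [inf B] of the left ones, and every number between them is a
    supergradient. If the two agree, the difference quotient converges to their common value;
    otherwise they are two distinct supergradients. *)
Lemma supergrad_cvg {R : realType} (phi : R -> R) (x : R) :
  concave01 phi -> 0 < x < 1 ->
  (exists s, supergrad phi x s /\ derive1 phi x = s) \/
  exists s t, [/\ s < t, supergrad phi x s & supergrad phi x t].
Proof.
move=> hc /andP[x0 x1].
pose slope y := (phi y - phi x) / (y - x).
pose A := [set slope y | y in [set y | x < y <= 1]].
pose B := [set slope y | y in [set y | 0 <= y < x]].
have slopeE y : y != x -> phi y = phi x + slope y * (y - x).
  by move=> yx; rewrite /slope divfK ?subr_eq0//; ring.
have slope_ni y z : 0 <= y -> y != x -> z != x -> y <= z -> z <= 1 ->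
    slope z <= slope y.
  move=> y0 yx zx yz z1; have [yz'|] := ltP y z; last first.
    by move=> zy; have -> // : y = z by lra.
  have slopeN a b : (phi a - phi b) / (a - b) = (phi b - phi a) / (b - a).
    by rewrite -opprB -(opprB b) invrN mulrNN.
  (* When [y] and [z] lie on the same side of [x], the chord inequality involves the slope between
     [y] and [z]; clearing denominators turns it into a comparison of the two slopes issued from
     [x]. *)
  have [yx'|xy'|e] := ltgtP y x; last by rewrite e eqxx in yx.
    have [zx'|xz'|e] := ltgtP z x; last by rewrite e eqxx in zx.
    - have := concave01_chord phi y z x hc y0 yz' zx' (ltW x1).
      rewrite /slope ler_pdivrMr ?subr_gt0// mulrAC ler_pdivlMr ?subr_gt0// => h.
      rewrite -(slopeN x z) -(slopeN x y) ler_pdivrMr ?subr_gt0// mulrAC ler_pdivlMr ?subr_gt0//.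
      lra.
    - rewrite /slope -(slopeN x y); exact: concave01_chord.
  have xz' : x < z by exact: lt_trans yz'.
  have := concave01_chord phi x y z hc (ltW x0) xy' yz' z1.
  rewrite /slope ler_pdivrMr ?subr_gt0// mulrAC ler_pdivlMr ?subr_gt0// => h.
  rewrite ler_pdivrMr ?subr_gt0// mulrAC ler_pdivlMr ?subr_gt0//.
  lra.
have A0 : A !=set0 by exists (slope 1), 1 => //=; lra.
have B0 : B !=set0 by exists (slope 0), 0 => //=; lra.
have AB a b : A a -> B b -> a <= b.
  move=> [y /= hy <-] [z /= hz <-]; apply: slope_ni; lra.
have hA : has_sup A.
  by split => //; case: B0 => b Bb; exists b => a Aa; exact: AB.
have hB : has_inf B.
  by split => //; case: A0 => a Aa; exists a => b Bb; exact: AB.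
have sup_inf : sup A <= inf B.
  apply: lb_le_inf => // b Bb; apply: ge_sup => // a Aa; exact: AB.
have sg s : sup A <= s -> s <= inf B -> supergrad phi x s.
  move=> sA sB y /OmegaE /andP[y0 y1].
  have [yx|xy|->] := ltgtP y x; last by lra.
    have : s <= slope y.
      by apply: le_trans sB _; apply: ge_inf; [case: hB|exists y => //=; lra].
    rewrite {1}slopeE; last by lra.
    move=> ?; nra.
  have : slope y <= s.
    by apply: le_trans sA; apply: ub_le_sup; [case: hA|exists y => //=; lra].
  rewrite {1}slopeE; last by lra.
  move=> ?; nra.
move: sup_inf; rewrite le_eqVlt => /orP[/eqP e|lt]; last first.
  by right; exists (sup A), (inf B); split => //; apply: sg => //; exact: ltW.
left; exists (sup A); split; first by apply: sg; rewrite ?e.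
apply/cvg_lim => //; apply/cvgrPdist_lt => eps eps0.
(* Take [a] right of [x] and [b] left of [x] with slopes within [eps] of the common value. For small
   [h] the point [h + x] lies between [b] and [a], and monotonicity of the slope squeezes its
   value. *)
have [_ [a /= ha <-] la] := sup_adherent eps0 hA.
have [_ [b /= hb <-] lb] := inf_adherent eps0 hB.
have dpos : 0 < Num.min (a - x) (x - b) by rewrite lt_min; lra.
near=> h.
have hne : h != 0 by near: h; exact: nbhs_dnbhs_neq.
have hsm : `|h| < Num.min (a - x) (x - b).
  near: h; apply: dnbhs0_lt; exact: dpos.
rewrite (_ : _ *: _ = slope (h + x)); last by rewrite /slope addrK mulrC.
suff: `|sup A - slope (h + x)| < eps by [].
move: hsm; rewrite lt_min !ltr_norml => /andP[/andP[h1 h2] /andP[h3 h4]].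
have [h0|h0|h0] := ltgtP h 0; last by rewrite h0 eqxx in hne.
  have s1 : slope (h + x) <= slope b by apply: slope_ni; lra.
  have s2 : inf B <= slope (h + x).
    by apply: ge_inf; [case: hB|exists (h + x) => //=; lra].
  by lra.
have s1 : slope a <= slope (h + x) by apply: slope_ni; lra.
have s2 : slope (h + x) <= sup A.
  by apply: ub_le_sup; [case: hA|exists (h + x) => //=; lra].
lra.
Unshelve. all: by end_near. Qed.

Lemma measurable_Omega {R : realType} : measurable (Omega R).
Proof. exact: measurable_itv. Qed.

Lemma supergrad_le {R : realType} (phi : R -> R) (x y s t : R) :
  Omega R x -> Omega R y -> x < y -> supergrad phi x s -> supergrad phi y t ->
  t <= s.
Proof.
move=> Ox Oy xy /(_ _ Oy) hs /(_ _ Ox) ht.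
have : t * (y - x) <= s * (y - x) by lra.
by rewrite ler_pM2r ?subr_gt0.
Qed.

Definition kinks {R : realType} (phi : R -> R) : set R :=
  [set x | 0 < x < 1 /\
    exists s t, [/\ s < t, supergrad phi x s & supergrad phi x t]].

(** Supergradients weakly decrease from left to right, so rationals chosen strictly between two
    supergradients at each kink strictly decrease. The choice is therefore injective. *)
Lemma countable_kinks {R : realType} (phi : R -> R) : countable (kinks phi).
Proof.
pose P x (q : rat) := kinks phi x -> exists s t,
  [/\ s < ratr q, ratr q < t, supergrad phi x s & supergrad phi x t].
have [q hq] : {q : R -> rat & forall x, P x (q x)}.
  apply: choice => x; rewrite /P.
  (* Off the kinks [P] holds vacuously, and 0 is a mere default. *)
  have [[_ [s [t [st hs ht]]]]|nk] := pselect (kinks phi x); last by exists 0.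
  have [q] := rat_in_itvoo st; rewrite in_itv/= => /andP[sq qt].
  by exists q => _; exists s, t.
have q_decr x y : kinks phi x -> kinks phi y -> x < y -> q y < q x.
  move=> kx ky xy; rewrite -(ltr_rat R).
  have [s [_ [sq _ hs _]]] := hq x kx; have [_ [t [_ qt _ ht]]] := hq y ky.
  have [[/andP[x0 x1] _] [/andP[y0 y1] _]] := (kx, ky).
  have : t <= s by apply: (@supergrad_le _ phi x y) => //; apply/OmegaE; lra.
  lra.
apply/countable_injP; exists (fun x => pickle (q x)) => x y.
rewrite !inE => kx ky /(pcan_inj pickleK) e.
by have [/(q_decr _ _ kx ky)|/(q_decr _ _ ky kx)|//] := ltgtP x y;
  rewrite e ltxx.
Qed.

(* Elsewhere in [0,1] derive1 phi may be a junk value; at 0 and 1 it depends on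
   phi outside [0,1]. *)
Definition smooth {R : realType} (phi : R -> R) : set R := `]0, 1[ `\` kinks phi.

Lemma smooth_itv {R : realType} (phi : R -> R) (x : R) :
  smooth phi x -> 0 < x < 1.
Proof. by case; rewrite /= in_itv. Qed.

Lemma measurable_smooth {R : realType} (phi : R -> R) : measurable (smooth phi).
Proof.
apply: measurableD => //; apply: countable_measurable; first exact: measurable_set1.
exact: countable_kinks.
Qed.

Lemma countable_not_smooth {R : realType} (phi : R -> R) :
  countable (Omega R `\` smooth phi).
Proof.
apply: (@sub_countable _ _ _ ([set 0; 1] `|` kinks phi)).
  apply: subset_card_le => x [/OmegaE /andP[x0 x1] ns].
  have [->|x0'] := eqVneq x 0; first by left; left.
  have [->|x1'] := eqVneq x 1; first by left; right.
  have [k|nk] := pselect (kinks phi x); first by right.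
  by exfalso; apply: ns; split => //; rewrite /= in_itv/=; lra.
rewrite -bigcup2E; apply: bigcup_countable => [|[|[|n]] _ /=]; [exact: countableP|
  |exact: countable_kinks|exact: countable0].
exact: finite_set_countable.
Qed.

Lemma supergrad_derive1 {R : realType} (phi : R -> R) (x : R) :
  concave01 phi -> smooth phi x -> supergrad phi x (derive1 phi x).
Proof.
move=> hc sx; have [_ nk] := sx.
have [[s [sg ->]] //|k] := supergrad_cvg phi x hc (smooth_itv phi x sx).
by exfalso; apply: nk; split => //; exact: (smooth_itv _ _ sx).
Qed.

(** * Discarding the countable exceptional set from integrals *)

Lemma integral_setD_null {R : realType} (D N : set R) (f : R -> \bar R) :
  measurable D -> measurable N -> measurable_fun D f -> leb N = 0%E ->
  (\int[leb]_(x in D) f x = \int[leb]_(x in D `\` N) f x)%E.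
Proof.
move=> mD mN mf N0; rewrite integralE [RHS]integralE.
congr (_ - _)%E; apply: ge0_negligible_integral => //.
  exact: measurable_funepos.
exact: measurable_funeneg.
Qed.

Lemma countable_measurable_fun {R : realType} (D : set R) (f : R -> \bar R) :
  countable D -> measurable_fun D f.
Proof.
move=> cD _ Y _; apply: countable_measurable; first exact: measurable_set1.
by apply: sub_countable cD; apply: subset_card_le; exact: subIsetl.
Qed.

(** Measurability is asked only where [derive1 phi] is under control. The rest of [0,1] is
    countable, hence null, and every function is measurable on it. *)
Lemma integral_smooth {R : realType} (phi : R -> R) (f : R -> \bar R) :
  measurable_fun (smooth phi) f ->
  (\int[leb]_(x in Omega R) f x = \int[leb]_(x in smooth phi) f x)%E.
Proof.
move=> mf; have cN := countable_not_smooth phi.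
have sO : smooth phi `<=` Omega R.
  by move=> x /smooth_itv ?; apply/OmegaE; lra.
have sE : Omega R `\` (Omega R `\` smooth phi) = smooth phi.
  by rewrite setDD; apply: setIidr.
have mN : measurable (Omega R `\` smooth phi).
  by apply: countable_measurable => //; exact: measurable_set1.
have mf' : measurable_fun (Omega R) f.
  rewrite -(setDUK sO); apply: (measurable_funU f (measurable_smooth phi) mN).2.
  by split => //; exact: countable_measurable_fun.
rewrite (@integral_setD_null _ _ (Omega R `\` smooth phi)) ?sE//.
  exact: measurable_Omega.
exact: countable_lebesgue_measure0.
Qed.

(** * Bounds on phi and on its derivative *)

(** For 0 < h < t, concavity between 0 and [t] gives phi(t)/t <= phi(h)/h; let h tend to 0. *)
Lemma concave01_le_slope0 {R : realType} (phi : R -> R) (d t : R) :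
  concave01 phi -> phi 0 = 0 ->
  (phi h - phi 0) / h @[h --> 0^'+] --> d ->
  0 <= t <= 1 -> phi t <= d * t.
Proof.
move=> hc h0 hder /andP[]; rewrite le_eqVlt => /orP[/eqP <-|t0] t1.
  by rewrite h0 mulr0.
rewrite -ler_pdivrMr// -(cvg_lim _ hder)//.
apply: limr_ge; first exact: cvgP hder.
near=> h.
have h_gt0 : 0 < h by [].
have ht : h < t by near: h; exact: nbhs_right_lt.
have := hc t 0 (h / t).
rewrite h0 !mulr0 !addr0 divfK ?gt_eqF// subr0 => h1.
rewrite ler_pdivlMr// mulrAC mulrC mulrA mulrAC.
have -> : t^-1 * h * phi t = h / t * phi t by rewrite (mulrC h).
apply: h1; [apply/OmegaE; lra|apply/OmegaE; lra|].
by rewrite divr_ge0 ?ler_pdivrMr ?mul1r ?ltW.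
Unshelve. all: by end_near. Qed.

Lemma concave01_ge_id {R : realType} (phi : R -> R) (t : R) :
  concave01 phi -> phi 0 = 0 -> phi 1 = 1 -> 0 <= t <= 1 -> t <= phi t.
Proof.
move=> hc h0 h1 ht.
have := hc 1 0 t; rewrite h0 h1 !mulr0 !mulr1 !addr0; apply => //;
  apply/OmegaE; lra.
Qed.

Lemma derive1_nonincreasing {R : realType} (phi : R -> R) (x y : R) :
  concave01 phi -> smooth phi x -> smooth phi y -> x <= y ->
  derive1 phi y <= derive1 phi x.
Proof.
move=> hc sx sy; rewrite le_eqVlt => /orP[/eqP <- //|xy].
have := smooth_itv _ _ sx; have := smooth_itv _ _ sy => hy hx.
by apply: (supergrad_le phi x y) => //;
  [apply/OmegaE; lra|apply/OmegaE; lra| |]; exact: supergrad_derive1.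
Qed.

(** Test the supergradient inequality at 1, where phi attains its maximum. *)
Lemma derive1_smooth_ge0 {R : realType} (phi : R -> R) (x : R) :
  (forall t, Omega R t -> 0 <= phi t <= 1) -> concave01 phi -> phi 1 = 1 ->
  smooth phi x -> 0 <= derive1 phi x.
Proof.
move=> hr hc h1 sx; have hx := smooth_itv _ _ sx.
have O1 : Omega R 1 by apply/OmegaE; lra.
have := supergrad_derive1 _ _ hc sx _ O1.
have /hr : Omega R x by apply/OmegaE; lra.
rewrite h1 => /andP[_ px] h.
have : 0 <= derive1 phi x * (1 - x) by lra.
by rewrite pmulr_lge0; lra.
Qed.

(** The supergradient inequality tested at 0 gives phi'(x) x <= phi(x) <= d x. *)
Lemma derive1_smooth_le {R : realType} (phi : R -> R) (d x : R) :
  concave01 phi -> phi 0 = 0 ->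
  (forall t, 0 <= t <= 1 -> phi t <= d * t) ->
  smooth phi x -> derive1 phi x <= d.
Proof.
move=> hc h0 hd sx; have hx := smooth_itv _ _ sx.
have O0 : Omega R 0 by apply/OmegaE; lra.
have := supergrad_derive1 _ _ hc sx _ O0; rewrite h0 => h.
have : phi x <= d * x by apply: hd; lra.
move=> h'; have : derive1 phi x * x <= d * x by lra.
by rewrite ler_pM2r; lra.
Qed.

Lemma measurable_derive1_smooth {R : realType} (phi : R -> R) :
  concave01 phi -> measurable_fun (smooth phi) (fun x => (derive1 phi x)%:E).
Proof.
move=> hc; apply: nonincreasing_on_measurable; first exact: measurable_smooth.
by move=> x y sx sy xy; rewrite lee_fin; exact: derive1_nonincreasing.
Qed.

(** * The integral of phi' is at most 1 *)

Lemma integral_le_cst_itv {R : realType} (A : set R) (f : R -> \bar R) (b c k : R) :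
  measurable A -> A `<=` `]b, c] -> b <= c -> measurable_fun A f ->
  (forall x, A x -> (0 <= f x <= k%:E)%E) -> 0 <= k ->
  (\int[leb]_(x in A) f x <= (k * (c - b))%:E)%E.
Proof.
move=> mA Abc bc mf fk k0.
apply: (@le_trans _ _ (\int[leb]_(x in A) cst k%:E x)%E).
  by apply: ge0_le_integral => // x /fk /andP[].
rewrite integral_cst// EFinM; apply: lee_wpmul2l; first by rewrite lee_fin.
have /= := lebesgue_measure_itv `]b, c]; rewrite lte_fin => bcE.
apply: (@le_trans _ _ (leb `]b, c]%classic)).
  by apply: le_measure => //; rewrite inE.
rewrite bcE; case: ifPn => // _.
by rewrite lee_fin subr_ge0.
Qed.

(* On each of n+1 equal steps phi' is at most the slope of phi over the previous
   step, and at most d on the first one, so the sum telescopes up to d/(n+1). *)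
Lemma integral_derive1_le1 {R : realType} (phi : R -> R) (d : R) :
  (forall t, Omega R t -> 0 <= phi t <= 1) -> concave01 phi ->
  phi 0 = 0 -> phi 1 = 1 ->
  (forall t, 0 <= t <= 1 -> phi t <= d * t) ->
  (\int[leb]_(x in smooth phi) (derive1 phi x)%:E <= 1)%E.
Proof.
move=> hr hc h0 h1 hd.
have d0 : 0 <= d by have := hd 1; rewrite h1; lra.
pose A (b c : R) := smooth phi `&` `]b, c].
have mA b c : measurable (A b c).
  by apply: measurableI => //; exact: measurable_smooth.
have mf b c : measurable_fun (A b c) (fun x => (derive1 phi x)%:E).
  by apply: measurable_funS (measurable_derive1_smooth _ hc) => //;
    [exact: measurable_smooth|exact: subIsetl].
have step (a b c : R) : 0 <= a -> a < b -> b < c -> c <= 1 ->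
    (\int[leb]_(x in A b c) (derive1 phi x)%:E <=
      ((phi b - phi a) / (b - a) * (c - b))%:E)%E.
  move=> a0 ab bc c1; apply: integral_le_cst_itv => //; [exact: subIsetr|exact: ltW| |].
    move=> x [sx]; rewrite /= in_itv/= => /andP[bx xc].
    rewrite !lee_fin derive1_smooth_ge0//=.
    have hx := smooth_itv _ _ sx.
    (* phi'(x) is at most the slope over [b,x], by the supergradient inequality at [x] tested at
       [b], and that slope is at most the one over [a,b]. *)
    apply: le_trans (concave01_chord phi a b x hc a0 ab bx _); last by lra.
    have Ob : Omega R b by apply/OmegaE; lra.
    have := supergrad_derive1 _ _ hc sx _ Ob.
    by rewrite ler_pdivlMr ?subr_gt0// => ?; lra.
  (* The bounding slope is nonnegative, since it dominates the slope over [b,1] and phi(b) <= 1 =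
     phi(1). *)
  have Ob : Omega R b by apply/OmegaE; lra.
  have := concave01_chord phi a b 1 hc a0 ab.
  have /hr := Ob; rewrite h1 => /andP[_ b1] hh.
  have : 0 <= (1 - phi b) / (1 - b) by rewrite divr_ge0; lra.
  move=> /le_trans; apply; apply: hh; lra.
have bound n : (\int[leb]_(x in smooth phi) (derive1 phi x)%:E <=
    (1 + d / n.+1%:R)%:E)%E.
  have n0 : 0 < n.+1%:R :> R by rewrite ltr0n.
  pose u k : R := k%:R / n.+1%:R.
  have u0 k : 0 <= u k by rewrite divr_ge0.
  have uS k : u k.+1 = u k + n.+1%:R^-1.
    by rewrite /u -natr1 mulrDl mul1r.
  have iv0 : 0 < n.+1%:R^-1 :> R by rewrite invr_gt0.
  have ultS k : u k < u k.+1 by rewrite uS ltrDl.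
  have u_le1 k : (k <= n.+1)%N -> u k <= 1.
    by move=> kn; rewrite ler_pdivrMr// mul1r ler_nat.
  (* The integral reaches [u k.+1] but the bound stops at phi([u k]), because each step is
     controlled by the slope of the step before. The term d/(n+1) pays for the first step. *)
  have ind k : (k <= n)%N ->
      (\int[leb]_(x in A 0%R (u k.+1)) (derive1 phi x)%:E <=
        (d / n.+1%:R + phi (u k))%:E)%E.
    elim: k => [_|k ih kn].
      have -> : u 0%N = 0 by rewrite /u mul0r.
      rewrite h0 addr0 (_ : _ / _ = d * (u 1%N - 0)); last by rewrite subr0 /u mul1r.
      apply: integral_le_cst_itv => //; first exact: subIsetr.
      move=> x [sx _]; rewrite !lee_fin derive1_smooth_ge0//=.
      exact: derive1_smooth_le hd sx.
    have ->  : A 0 (u k.+2) = A 0 (u k.+1) `|` A (u k.+1) (u k.+2).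
      rewrite -setIUr; congr (_ `&` _).
      apply/seteqP; split => x /=; rewrite !in_itv/=.
        by move=> /andP[x0 x2]; have [xk|xk] := leP x (u k.+1); [left|right]; lra.
      by have hk0 := u0 k.+1; have hkS := ultS k.+1; case => /andP[? ?]; lra.
    rewrite ge0_integral_setU//; last 5 first.
    - exact: mA.
    - exact: mA.
    - by apply: (measurable_funU _ (mA _ _) (mA _ _)).2; split.
    - move=> x [[sx _]|[sx _]]; by rewrite lee_fin; apply: derive1_smooth_ge0.
    - rewrite disj_set2E; apply/eqP/seteqP; split => // x [[_ /=]].
      by rewrite in_itv/= => ? [_ /=]; rewrite in_itv/=; lra.
    have := step (u k) (u k.+1) (u k.+2) (u0 k).
    have -> : u k.+1 - u k = n.+1%:R^-1 by rewrite uS; ring.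
    have -> : u k.+2 - u k.+1 = n.+1%:R^-1 by rewrite (uS k.+1); ring.
    rewrite invrK mulfK ?gt_eqF// => st.
    apply: le_trans (leeD (ih (ltnW kn)) (st _ _ _)) _.
    - exact: ultS.
    - exact: ultS.
    - exact: u_le1.
    by rewrite -EFinD lee_fin -addrA [phi (u k) + _]addrC subrK.
  have := ind n (leqnn n).
  have -> : u n.+1 = 1 by rewrite /u divff// gt_eqF.
  have -> : A 0 1 = smooth phi.
    apply: setIidl => x /smooth_itv /andP[x0 x1].
    by rewrite /= in_itv/= x0 ltW.
  move=> /le_trans; apply; rewrite lee_fin addrC lerD2r.
  have /hr /andP[_] // : Omega R (u n).
  by apply/OmegaE; rewrite u0 u_le1.
apply/lee_addgt0Pr => e e0.
(* As n + 1 > d/e, the excess d/(n+1) is below [e]. *)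
pose n := Num.trunc (d / e).
apply: le_trans (bound n) _.
rewrite -EFinD lee_fin lerD2l ler_pdivrMr ?ltr0n// mulrC -ler_pdivrMr//.
by apply/ltW; rewrite truncnS_gt.
Qed.

(** * The Lorentz norm bounded by the integral of the rearrangement over [0,a] *)

Lemma integral_cst_itv0 {R : realType} (a : R) (r : \bar R) : 0 <= a ->
  (\int[leb]_(w in `[0%R, a]) cst r w = r * a%:E)%E.
Proof.
move=> a0; rewrite integral_cst//; congr (_ * _)%E.
have := lebesgue_measure_itv `[0, a]; rewrite /= lte_fin sube0 => ->.
by case: ltgtP a0 => // <-.
Qed.

Lemma integral_smoothI {R : realType} (phi : R -> R) (D : set R) (f : R -> \bar R) :
  D `<=` Omega R -> measurable D -> measurable_fun D f ->
  (\int[leb]_(x in D) f x = \int[leb]_(x in smooth phi `&` D) f x)%E.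
Proof.
move=> DO mD mf; have cN := countable_not_smooth phi.
rewrite (@integral_setD_null _ _ (Omega R `\` smooth phi))//.
- congr (integral _ _ _); apply/seteqP; split => x /=.
    by move=> [Dx nN]; split => //; apply: contrapT => ns; apply: nN; split => //; exact: DO.
  by move=> [sx Dx]; split => // -[].
- by apply: countable_measurable => //; exact: measurable_set1.
- exact: countable_lebesgue_measure0.
Qed.

Lemma integral_setI_itv {R : realType} (E : set R) (f : R -> \bar R) (a : R) :
  measurable E -> measurable_fun E f -> (forall x, E x -> 0 <= f x)%E ->
  E `<=` Omega R -> 0 <= a <= 1 ->
  (\int[leb]_(x in E) f x = \int[leb]_(x in E `&` `[0%R, a]) f x +
    \int[leb]_(x in E `&` `]a, 1%R]) f x)%E.
Proof.
move=> mE mf f0 EO a01.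
have mA : measurable (E `&` `[0, a]) by exact: measurableI.
have mB : measurable (E `&` `]a, 1]) by exact: measurableI.
have EE : E = (E `&` `[0, a]) `|` (E `&` `]a, 1]).
  rewrite -setIUr; apply/esym/setIidl => x /EO /OmegaE x01 /=.
  by rewrite !in_itv/=; have [xa|xa] := leP x a; [left|right]; lra.
rewrite {1}EE ge0_integral_setU//.
- by rewrite -EE.
- by move=> x; rewrite -EE; exact: f0.
- rewrite disj_set2E; apply/eqP/seteqP; split => // x [[_ /=]].
  by rewrite in_itv/= => ? [_ /=]; rewrite in_itv/=; lra.
Qed.

Lemma smooth_sub_Omega {R : realType} (phi : R -> R) : smooth phi `<=` Omega R.
Proof. by move=> x /smooth_itv ?; apply/OmegaE; lra. Qed.

(** Both factors are nonnegative and nonincreasing, hence so is the product. *)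
Lemma measurable_rearr_derive1 {R : realType} (phi : R -> R) (X : R -> R) :
  (forall t, Omega R t -> 0 <= phi t <= 1) -> concave01 phi -> phi 1 = 1 ->
  measurable_fun (smooth phi) (fun w => (rearr X w * (derive1 phi w)%:E)%E).
Proof.
move=> hr hc h1; apply: nonincreasing_on_measurable; first exact: measurable_smooth.
move=> x y sx sy xy; apply: lee_pmul; first exact: rearr_ge0.
- by rewrite lee_fin; exact: derive1_smooth_ge0.
- exact: rearr_nonincreasing.
- by rewrite lee_fin; exact: derive1_nonincreasing.
Qed.

Lemma LorentzNormE {R : realType} (phi : R -> R) (X : R -> R) :
  (forall t, Omega R t -> 0 <= phi t <= 1) -> concave01 phi -> phi 1 = 1 ->
  LorentzNorm phi X =
    (\int[leb]_(w in smooth phi) (rearr X w * (derive1 phi w)%:E))%E.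
Proof. by move=> hr hc h1; apply: integral_smooth; exact: measurable_rearr_derive1. Qed.

Lemma rearr_le_integral {R : realType} (X : R -> R) (a : R) : 0 <= a ->
  (a%:E * rearr X a <= \int[leb]_(w in `[0%R, a]) rearr X w)%E.
Proof.
move=> a0; apply: (@le_trans _ _ (\int[leb]_(w in `[0%R, a]) cst (rearr X a) w)%E).
  by rewrite integral_cst_itv0// muleC.
apply: ge0_le_integral => //.
- by move=> x _; exact: rearr_ge0.
- exact: measurable_rearr.
by move=> x; rewrite /= in_itv/= => /andP[_ xa]; exact: rearr_nonincreasing.
Qed.

Lemma rearr_lty {R : realType} (X : R -> R) (a : R) : 0 < a ->
  (\int[leb]_(w in `[0%R, a]) rearr X w < +oo)%E -> (rearr X a < +oo)%E.
Proof.
move=> a0 I; have := le_lt_trans (rearr_le_integral X a (ltW a0)) I.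
have := rearr_ge0 X a; case: (rearr X a) => [r _ _|_|//]; first exact: ltry.
by rewrite mulry gtr0_sg// mul1e.
Qed.

(** With c = X^*(a), on ]a,1] one has X^* <= c, while on [0,a] the product (X^* - c)(d - phi') is
    nonnegative. To avoid subtraction in the extended reals, c is added to both sides and, being
    finite, cancelled at the end. *)
Lemma LorentzNorm_le {R : realType} (phi : R -> R) (d a : R) (X : R -> R) :
  (forall t, Omega R t -> 0 <= phi t <= 1) -> concave01 phi ->
  phi 0 = 0 -> phi 1 = 1 ->
  (forall t, 0 <= t <= 1 -> phi t <= d * t) ->
  0 < a <= 1 -> d * a = 1 -> (rearr X a < +oo)%E ->
  (LorentzNorm phi X <= d%:E * \int[leb]_(w in `[0%R, a]) rearr X w)%E.
Proof.
move=> hr hc h0 h1 hd /andP[a0 a1] da Xa.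
have d0 : 0 <= d by have := hd 1; rewrite h1; lra.
have [c c0 cE] : exists2 c : R, 0 <= c & rearr X a = c%:E.
  have := rearr_ge0 X a; move: Xa; case: (rearr X a) => // r _; rewrite lee_fin.
  by exists r.
rewrite LorentzNormE//.
set g := fun w : R => (derive1 phi w)%:E.
have mS := measurable_smooth phi; have SO := smooth_sub_Omega phi.
have mXg := measurable_rearr_derive1 phi X hr hc h1.
have mg := measurable_derive1_smooth phi hc.
have g0 w : smooth phi w -> (0 <= g w)%E.
  by move=> sw; rewrite lee_fin; exact: derive1_smooth_ge0.
have a01 : 0 <= a <= 1 by lra.
have Xg0 w : smooth phi w -> (0 <= rearr X w * g w)%E.
  by move=> sw; apply: mule_ge0; [exact: rearr_ge0|exact: g0].
rewrite (@integral_setI_itv _ _ _ a)//.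
set A := smooth phi `&` `[0, a]; set B := smooth phi `&` `]a, 1].
have mA : measurable A by exact: measurableI.
have mB : measurable B by exact: measurableI.
have AS : A `<=` smooth phi by exact: subIsetl.
have BS : B `<=` smooth phi by exact: subIsetl.
have aO : `[0, a] `<=` Omega R.
  by move=> x; rewrite /= in_itv/= => ?; apply/OmegaE; lra.
have hB : (\int[leb]_(w in B) (rearr X w * g w) <= c%:E * \int[leb]_(w in B) g w)%E.
  rewrite -ge0_integralZl_EFin//; last 2 first.
  - by move=> x /BS; exact: g0.
  - exact: measurable_funS mg.
  apply: ge0_le_integral => //.
  - by move=> x /BS; exact: Xg0.
  - exact: measurable_funS mXg.
  - by apply: measurable_funeM; exact: measurable_funS mg.
  move=> x Bx; apply: lee_wpmul2r; first exact/g0/BS.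
  rewrite -cE; apply: rearr_nonincreasing.
  by case: Bx => _; rewrite /= in_itv/=; lra.
have hA : (\int[leb]_(w in A) (rearr X w * g w) + c%:E <=
    d%:E * \int[leb]_(w in `[0%R, a]) rearr X w + c%:E * \int[leb]_(w in A) g w)%E.
  (* The set [A] has measure [a], and d a = 1. *)
  have {1}-> : c%:E = (\int[leb]_(w in A) cst ((d * c)%:E) w)%E :> \bar R.
    rewrite -integral_smoothI// integral_cst_itv0 ?ltW//.
    by rewrite -EFinM mulrAC da mul1r.
  rewrite (integral_smoothI phi `[0, a] (rearr X))//; last exact: measurable_rearr.
  have mX : measurable_fun A (rearr X) by exact: measurable_rearr.
  have mgA : measurable_fun A g by exact: measurable_funS mg.
  have mXgA : measurable_fun A (fun w => rearr X w * g w)%E by exact: measurable_funS mXg.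
  rewrite -ge0_integralZl_EFin//; last by move=> x _; exact: rearr_ge0.
  rewrite -(@ge0_integralZl_EFin _ _ _ leb A _ g)//; last by move=> x /AS; exact: g0.
  rewrite -ge0_integralD//; last 2 first.
  - by move=> x /AS; exact: Xg0.
  - by move=> x _; rewrite lee_fin mulr_ge0.
  rewrite -ge0_integralD//; last 4 first.
  - by move=> x _; apply: mule_ge0; [rewrite lee_fin|exact: rearr_ge0].
  - exact: measurable_funeM.
  - by move=> x /AS/g0 ?; apply: mule_ge0 => //; rewrite lee_fin.
  - exact: measurable_funeM.
  apply: ge0_le_integral => //.
  - move=> x /AS sx; apply: adde_ge0; first exact: Xg0.
    by rewrite lee_fin mulr_ge0.
  - exact: emeasurable_funD.
  - by apply: emeasurable_funD; exact: measurable_funeM.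
  move=> x Ax; have gx0 := g0 _ (AS _ Ax).
  have gd : derive1 phi x <= d := derive1_smooth_le _ _ _ hc h0 hd (AS _ Ax).
  have : (c%:E <= rearr X x)%E.
    rewrite -cE; apply: rearr_nonincreasing.
    by case: Ax => _; rewrite /= in_itv/= => /andP[].
  rewrite /g lee_fin in gx0 *.
  case: (rearr X x) => [r| |//].
    rewrite lee_fin => cr; rewrite -!EFinM -!EFinD lee_fin; nra.
  (* Where X^* is infinite so is the right side, because d > 0. *)
  move=> _; have dy : (d%:E * +oo = +oo :> \bar R)%E.
    by rewrite mulry gtr0_sg ?mul1e//; nra.
  by rewrite dy addye ?leey.
have : (\int[leb]_(w in A) (rearr X w * g w) + \int[leb]_(w in B) (rearr X w * g w) + c%:E <=
    d%:E * \int[leb]_(w in `[0%R, a]) rearr X w + c%:E)%E.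
  rewrite addeAC; apply: le_trans (leeD hA hB) _.
  rewrite -addeA leeD2l// -ge0_muleDr; last 2 first.
  - by apply: integral_ge0 => x /AS; exact: g0.
  - by apply: integral_ge0 => x /BS; exact: g0.
  rewrite -integral_setI_itv//.
  rewrite -[leRHS]mule1; apply: lee_wpmul2l; first by rewrite lee_fin.
  exact: (integral_derive1_le1 phi d).
by rewrite leeD2rE.
Qed.

(** * Comparison of the Lorentz and Marcinkiewicz spaces *)

Lemma MarcNorm_ge {R : realType} (phi : R -> R) (X : R -> R) (t : R) :
  0 < t <= 1 ->
  ((phi t / t)%:E * \int[leb]_(w in `[0%R, t]) rearr X w <= MarcNorm phi X)%E.
Proof. by move=> t01; apply: ereal_sup_ubound; exists t => //; rewrite /= in_itv. Qed.

Lemma integral_rearr_le {R : realType} (X : R -> R) (s t : R) : s <= t ->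
  (\int[leb]_(w in `[0%R, s]) rearr X w <= \int[leb]_(w in `[0%R, t]) rearr X w)%E.
Proof.
move=> st; apply: ge0_subset_integral => //.
- exact: measurable_rearr.
- by move=> x _; exact: rearr_ge0.
by move=> x; rewrite /= !in_itv/= => /andP[-> /le_trans]; apply.
Qed.

Lemma MarcSpace_integral_lty {R : realType} (phi : R -> R) (X : R -> R) :
  phi 1 = 1 -> MarcSpace phi X -> (\int[leb]_(w in `[0%R, 1%R]) rearr X w < +oo)%E.
Proof.
move=> h1 [_ M]; apply: le_lt_trans M.
have := @MarcNorm_ge _ phi X 1; rewrite h1 divr1 mul1e; apply; lra.
Qed.

Lemma LorentzNorm_le_MarcNorm {R : realType} (phi : R -> R) (d : R) (X : R -> R) :
  (forall t, Omega R t -> 0 <= phi t <= 1) -> concave01 phi ->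
  phi 0 = 0 -> phi 1 = 1 ->
  (forall t, 0 <= t <= 1 -> phi t <= d * t) ->
  MarcSpace phi X ->
  (LorentzNorm phi X <= (phi d^-1)^-1%:E * MarcNorm phi X)%E.
Proof.
move=> hr hc h0 h1 hd MX.
have d1 : 1 <= d by have := hd 1; rewrite h1; lra.
have a0 : 0 < d^-1 by rewrite invr_gt0; lra.
have a1 : d^-1 <= 1 by rewrite invf_le1; lra.
have pa : 0 < phi d^-1.
  by apply: lt_le_trans (concave01_ge_id _ _ hc h0 h1 _) => //; lra.
have Xa : (rearr X d^-1 < +oo)%E.
  apply: rearr_lty => //; apply: le_lt_trans (MarcSpace_integral_lty phi X h1 MX).
  exact: integral_rearr_le.
have dd : d * d^-1 = 1 by rewrite divff; lra.
apply: le_trans (LorentzNorm_le phi d d^-1 X hr hc h0 h1 hd _ dd Xa) _; first lra.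
(* For a = 1/d, the factor d is 1/phi(a) times the coefficient phi(a)/a of the term t = a in the
   Marcinkiewicz supremum. *)
have dE : d%:E = ((phi d^-1)^-1%:E * (phi d^-1 / d^-1)%:E)%E.
  by rewrite -EFinM invrK mulrA mulVf ?mul1r// gt_eqF.
rewrite {1}dE -muleA; apply: lee_wpmul2l.
  by rewrite lee_fin invr_ge0 ltW.
by apply: MarcNorm_ge; rewrite a0.
Qed.

(** Put e = 1/(2d), so that phi <= 1/2 on [0,e]. The supergradient inequality tested at 1 then gives
    phi' >= 1/2 at smooth points of [0,e], so the Lorentz norm controls the integral of X^* there.
    Beyond [e], X^* is bounded by the finite value X^*(e). *)
Lemma LorentzSpace_integral_lty {R : realType} (phi : R -> R) (d : R) (X : R -> R) :
  (forall t, Omega R t -> 0 <= phi t <= 1) -> concave01 phi ->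
  phi 0 = 0 -> phi 1 = 1 ->
  (forall t, 0 <= t <= 1 -> phi t <= d * t) ->
  (LorentzNorm phi X < +oo)%E ->
  (\int[leb]_(w in `[0%R, 1%R]) rearr X w < +oo)%E.
Proof.
move=> hr hc h0 h1 hd; rewrite LorentzNormE// => L.
have d1 : 1 <= d by have := hd 1; rewrite h1; lra.
pose e := (2 * d)^-1.
have de : d * e = 2^-1 by rewrite /e invfM mulrCA divff ?mulr1//; lra.
have e0 : 0 < e by rewrite invr_gt0; lra.
have e1 : e <= 1 by nra.
have mS := measurable_smooth phi.
have mXg := measurable_rearr_derive1 phi X hr hc h1.
have Xg0 w : smooth phi w -> (0 <= rearr X w * (derive1 phi w)%:E)%E.
  move=> sw; apply: mule_ge0; first exact: rearr_ge0.
  by rewrite lee_fin; exact: derive1_smooth_ge0.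
have g_ge w : smooth phi w -> w <= e -> 1 <= 2 * derive1 phi w.
  move=> sw we; have hw := smooth_itv _ _ sw.
  have O1 : Omega R 1 by apply/OmegaE; lra.
  have := supergrad_derive1 _ _ hc sw _ O1; rewrite h1.
  have := derive1_smooth_ge0 _ _ hr hc h1 sw.
  have : phi w <= d * w by apply: hd; lra.
  have : d * w <= d * e by rewrite ler_pM2l; lra.
  nra.
have eO : `[0, e] `<=` Omega R.
  by move=> x; rewrite /= in_itv/= => ?; apply/OmegaE; lra.
have mA : measurable (smooth phi `&` `[0, e]) by exact: measurableI.
have Ie : (\int[leb]_(w in `[0%R, e]) rearr X w < +oo)%E.
  rewrite (integral_smoothI phi)//; last exact: measurable_rearr.
  apply: (@le_lt_trans _ _ (2%:E * \int[leb]_(w in smooth phi) (rearr X w * (derive1 phi w)%:E))%E); last first.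
    by rewrite lte_mul_pinfty.
  apply: (@le_trans _ _ (2%:E * \int[leb]_(w in smooth phi `&` `[0%R, e]) (rearr X w * (derive1 phi w)%:E))%E); last first.
    by apply: lee_wpmul2l; [rewrite lee_fin|apply: ge0_subset_integral].
  rewrite -ge0_integralZl_EFin//; last 2 first.
  - by move=> x [/Xg0].
  - exact: measurable_funS mXg.
  apply: ge0_le_integral => //.
  - by move=> x _; exact: rearr_ge0.
  - exact: measurable_rearr.
  - by apply: measurable_funeM; exact: measurable_funS mXg.
  move=> x [sx]; rewrite /= in_itv/= => /andP[_ xe].
  rewrite muleCA -[leLHS]mule1; apply: lee_wpmul2l; first exact: rearr_ge0.
  by rewrite -EFinM lee_fin; exact: g_ge.
have Xe := rearr_lty X e e0 Ie.
have [c c0 cE] : exists2 c : R, 0 <= c & rearr X e = c%:E.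
  have := rearr_ge0 X e; move: Xe; case: (rearr X e) => // r _; rewrite lee_fin.
  by exists r.
rewrite (@integral_setI_itv _ _ _ e)//; last 3 first.
- exact: measurable_rearr.
- by move=> x _; exact: rearr_ge0.
- by lra.
rewrite (_ : `[0, 1]%classic `&` `[0, e]%classic = `[0, e]%classic); last first.
  by apply/setIidr; exact: eO.
apply: lte_add_pinfty => //.
apply: (@le_lt_trans _ _ (c * (1 - e))%:E); last exact: ltry.
apply: integral_le_cst_itv => //.
- exact: measurableI.
- by apply: measurable_rearr; exact: measurableI.
move=> x [_]; rewrite /= in_itv/= => /andP[ex _].
by rewrite rearr_ge0/= -cE; apply: rearr_nonincreasing; exact: ltW.
Qed.

(** Every coefficient phi(t)/t in the supremum is at most d. *)
Lemma MarcNorm_le_integral {R : realType} (phi : R -> R) (d : R) (X : R -> R) :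
  (forall t, Omega R t -> 0 <= phi t <= 1) ->
  (forall t, 0 <= t <= 1 -> phi t <= d * t) ->
  (MarcNorm phi X <= d%:E * \int[leb]_(w in `[0%R, 1%R]) rearr X w)%E.
Proof.
move=> hr hd; apply: ge_ereal_sup => _ [t /= t01 <-].
move: t01; rewrite in_itv/= => /andP[t0 t1].
have Ot : Omega R t by apply/OmegaE; lra.
apply: lee_pmul.
- by have /andP[p0 _] := hr _ Ot; rewrite lee_fin divr_ge0// ltW.
- by apply: integral_ge0 => x _; exact: rearr_ge0.
- by rewrite lee_fin ler_pdivrMr//; apply: hd; lra.
- exact: integral_rearr_le.
Qed.

Lemma LorentzSpace_MarcSpace {R : realType} (phi : R -> R) (d : R) :
  (forall t, Omega R t -> 0 <= phi t <= 1) -> concave01 phi ->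
  phi 0 = 0 -> phi 1 = 1 ->
  (forall t, 0 <= t <= 1 -> phi t <= d * t) ->
  LorentzSpace phi = MarcSpace phi.
Proof.
move=> hr hc h0 h1 hd; have d1 : 1 <= d by have := hd 1; rewrite h1; lra.
apply/seteqP; split => X [mX NX]; split => //.
  apply: le_lt_trans (MarcNorm_le_integral phi d X hr hd) _.
  rewrite lte_mul_pinfty// ?lee_fin; first by lra.
  exact: (LorentzSpace_integral_lty phi d X).
have MX : MarcSpace phi X by [].
apply: le_lt_trans (LorentzNorm_le_MarcNorm phi d X hr hc h0 h1 hd MX) _.
rewrite lte_mul_pinfty// lee_fin invr_ge0.
have /hr /andP[] // : Omega R d^-1.
by apply/OmegaE; rewrite invr_ge0 invf_le1; lra.
Qed.

(** * Rearrangement invariant norms against the integral *)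

(** This is the case of simple functions, by induction on [s]. The norm is subadditive and the
    integral additive, which leaves a single indicator, where the fundamental function is bounded by
    phi(t) <= d t. The sets are cut down to [0,1] because level sets of simple functions live in the
    whole line. *)
Lemma ri_sum_indic_le {R : realType} (Rn : (R -> R) -> \bar R) (phi : R -> R)
    (d : R) (s : seq R) (E : R -> set R) :
  ri_bfn Rn -> has_fundamental Rn phi -> 0 <= d ->
  (forall t, 0 <= t <= 1 -> phi t <= d * t) ->
  (forall r, measurable (E r)) -> {in s, forall r, 0 <= r} ->
  let f := fun w => \sum_(r <- s) r * \1_(E r `&` Omega R) w in
  nnmeas f /\ (Rn f <= d%:E * \int[leb]_(w in Omega R) (f w)%:E)%E.
Proof.
move=> [_ [hhom [hsub _]]] hfund d0 hd mE.
have mO := @measurable_Omega R.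
have mEO r : measurable (E r `&` Omega R) by exact: measurableI.
have mi r : measurable_fun (Omega R) (\1_(E r `&` Omega R) : R -> R).
  by apply: measurable_indic; exact: mEO.
elim: s => [_|r s ih rs].
  have m0 : nnmeas (fun=> 0 : R) by split.
  have f0 : (fun w : R => \sum_(r <- [::]) r * \1_(E r `&` Omega R) w) = (fun=> 0 : R).
    by apply/funext => w; rewrite big_nil.
  rewrite f0; split => //.
  (* The norm of the zero function vanishes by homogeneity with factor 0. *)
  have := hhom _ 0 m0 (lexx _); rewrite mul0e.
  rewrite (_ : (fun=> _) = (fun=> 0)); last by apply/funext => w; rewrite mul0r.
  by move=> ->; apply: mule_ge0 => //; apply: integral_ge0.
have r0 : 0 <= r by apply: rs; rewrite mem_head.
have /ih[mf fle] : {in s, forall x, 0 <= x}.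
  by move=> x xs; apply: rs; rewrite inE xs orbT.
set g := fun w => _ in mf fle.
have mi' : nnmeas (\1_(E r `&` Omega R)) by split.
have mri : nnmeas (fun w => r * \1_(E r `&` Omega R) w).
  by split => [|w _]; [exact: measurable_funM|exact: mulr_ge0].
have -> : (fun w => \sum_(r0 <- r :: s) r0 * \1_(E r0 `&` Omega R) w) =
    (fun w => r * \1_(E r `&` Omega R) w + g w).
  by apply/funext => w; rewrite big_cons.
split.
  split => [|w Ow]; first by apply: measurable_funD; [exact: mri.1|exact: mf.1].
  by apply: addr_ge0; [exact: mri.2|exact: mf.2].
apply: le_trans (hsub _ _ mri mf) _.
under eq_integral do rewrite EFinD.
rewrite ge0_integralD//; last 4 first.
- by move=> w Ow; rewrite lee_fin; exact: mri.2.
- by apply/measurable_EFinP; exact: mri.1.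
- by move=> w Ow; rewrite lee_fin; exact: mf.2.
- by apply/measurable_EFinP; exact: mf.1.
rewrite ge0_muleDr; last 2 first.
- by apply: integral_ge0 => w Ow; rewrite lee_fin; exact: mri.2.
- by apply: integral_ge0 => w Ow; rewrite lee_fin; exact: mf.2.
apply: leeD => //.
rewrite hhom// (hfund _ (mEO r) (@subIsetr _ _ _)).
under eq_integral do rewrite EFinM.
rewrite ge0_integralZl_EFin//; last by apply/measurable_EFinP; exact: mi.
rewrite integral_indic//; last exact: mEO.
have -> : E r `&` Omega R `&` Omega R = E r `&` Omega R by rewrite -setIA setIid.
rewrite muleCA.
apply: lee_wpmul2l; first by rewrite lee_fin.
set m := leb _.
have m1 : (m <= 1)%E.
  have -> : (1 = leb (Omega R))%E.
    by have := lebesgue_measure_itv `[0 : R, 1]; rewrite /= lte_fin ltr01 oppr0 adde0 => <-.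
  apply: le_measure; [by rewrite inE; exact: mEO|by rewrite inE|exact: subIsetr].
have m0 : (0 <= m)%E by exact: measure_ge0.
suff h y : (0 <= y -> y <= 1 -> (phi (fine y))%:E <= d%:E * y)%E by exact: h m m0 m1.
case: y => [y| |]//; rewrite !lee_fin => y0 y1.
by apply: hd; rewrite y0.
Qed.

Import HBNNSimple.

(** Approximate [X] from below by an increasing sequence of simple functions: each satisfies the
    bound, and the Fatou property carries it to the limit. *)
Lemma ri_le_integral {R : realType} (Rn : (R -> R) -> \bar R) (phi : R -> R)
    (d : R) (X : R -> R) :
  ri_bfn Rn -> has_fundamental Rn phi -> 0 <= d ->
  (forall t, 0 <= t <= 1 -> phi t <= d * t) -> nnmeas X ->
  (Rn X <= d%:E * \int[leb]_(w in Omega R) (X w)%:E)%E.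
Proof.
move=> hR hfund d0 hd mX.
have [_ [_ [_ [hmono [hfatou _]]]]] := hR.
have mO := @measurable_Omega R.
have mEX : measurable_fun (Omega R) (EFin \o X).
  by apply/measurable_EFinP; exact: mX.1.
have X0 w : Omega R w -> (0 <= (EFin \o X) w)%E.
  by move=> Ow; rewrite lee_fin; exact: mX.2.
pose f n : R -> R := nnsfun_approx mO mEX n.
have mf n : nnmeas (f n).
  by split => [|w _]; [exact: measurable_funTS|rewrite /f].
have f_nd w : {homo f^~ w : m n / (m <= n)%N >-> m <= n}.
  by move=> m n mn; have /lefP := nd_nnsfun_approx mO mEX mn; exact.
have f_cvg w : Omega R w -> f n w @[n --> \oo] --> X w.
  by move=> Ow; have /fine_cvgP[] := cvg_nnsfun_approx mO mEX X0 Ow.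
have fX n w : Omega R w -> f n w <= X w.
  move=> Ow; rewrite -(cvg_lim _ (f_cvg w Ow))//.
  by apply: nondecreasing_cvgn_le; [exact: f_nd|exact: cvgP (f_cvg w Ow)].
have fle n : (Rn (f n) <= d%:E * \int[leb]_(w in Omega R) (X w)%:E)%E.
  pose s : seq R := finmap.enum_fset (fset_set (range (f n))).
  have s0 : {in s, forall r, 0 <= r}.
    by move=> r; rewrite in_fset_set// inE => -[w _ <-]; rewrite /f.
  have mE r : measurable (f n @^-1` [set r]) by [].
  have [/= mg gle] := ri_sum_indic_le Rn phi d s (fun r => f n @^-1` [set r]) hR hfund d0 hd mE s0.
  set g := fun w => _ in mg gle.
  (* The canonical sum [g] matches [f n] only on [0,1]; monotonicity of the norm almost everywhere
     on [0,1] absorbs the difference. *)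
  have gf w : Omega R w -> g w = f n w.
    move=> Ow; rewrite /g {2}/f fimfunE fsbig_finite//=.
    apply: eq_bigr => r _; congr (_ * _); rewrite !indicE.
    by rewrite in_setI (mem_set Ow) andbT.
  apply: (@le_trans _ _ (Rn g)).
    apply: hmono => //; apply: aeW => w Ow; by rewrite gf.
  apply: le_trans gle _; apply: lee_wpmul2l; first by rewrite lee_fin.
  apply: ge0_le_integral => //.
  - by move=> w Ow; rewrite lee_fin; exact: mg.2.
  - by apply/measurable_EFinP; exact: mg.1.
  by move=> w Ow; rewrite lee_fin; have := fX n w Ow; rewrite -(gf w Ow).
have lim : Rn (f n) @[n --> \oo] --> Rn X.
  by apply: hfatou => //; apply: aeW => w Ow; split; [exact: f_nd|exact: f_cvg].
rewrite -(cvg_lim _ lim)//; apply: lime_le; first exact: cvgP lim.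
exact: nearW.
Qed.

Lemma ri_norm_dominated {R : realType} (Rn1 Rn2 : (R -> R) -> \bar R)
    (phi : R -> R) (d : R) :
  0 < d -> (forall t, 0 <= t <= 1 -> phi t <= d * t) ->
  ri_bfn Rn1 -> has_fundamental Rn1 phi -> ri_bfn Rn2 ->
  exists2 K : R, 0 < K & forall X, measurable_fun (Omega R) X ->
    (ri_norm_of Rn1 X <= K%:E * ri_norm_of Rn2 X)%E.
Proof.
move=> d0 hd hR1 hf1 hR2.
have [hpos [_ [_ [_ [_ [_ [hint _]]]]]]] := hR2.
have [c hc] := hint _ (@measurable_Omega R) (@subset_refl _ _).
(* The axiom yields a real [c] of unspecified sign; the maximum with 1 makes the constant
   positive. *)
exists (d * Num.max c 1); first by rewrite mulr_gt0// lt_max ltr01 orbT.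
move=> X mX.
have mA : nnmeas (fun w => `|X w|) by split => //; exact: measurableT_comp.
apply: le_trans (ri_le_integral Rn1 phi d _ hR1 hf1 (ltW d0) hd mA) _.
rewrite EFinM -muleA; apply: lee_wpmul2l; first by rewrite lee_fin ltW.
apply: le_trans (hc _ mA) _; apply: lee_wpmul2r; first exact: (hpos _ mA).1.
by rewrite lee_fin le_max lexx.
Qed.

Theorem theorem25 (R : realType) (phi : R -> R) (d : R)
  (hrange : forall t, Omega R t -> 0 <= phi t <= 1)
  (hconc : concave01 phi)
  (h0 : phi 0 = 0) (h1 : phi 1 = 1)
  (hcont : phi x @[x --> 0^'+] --> phi 0)
  (hder : (phi h - phi 0) / h @[h --> 0^'+] --> d) :
  (exists K : R, forall X, MarcSpace phi X ->
      (LorentzNorm phi X <= K%:E * MarcNorm phi X)%E)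
  /\ LorentzSpace phi = MarcSpace phi
  /\ (forall Rn1 Rn2 : (R -> R) -> \bar R,
        ri_bfn Rn1 -> has_fundamental Rn1 phi ->
        ri_bfn Rn2 -> has_fundamental Rn2 phi ->
        equiv_norms (ri_norm_of Rn1) (ri_norm_of Rn2))
  /\ (forall X, MarcSpace phi X ->
      (LorentzNorm phi X <= (phi d^-1)^-1%:E * MarcNorm phi X)%E).
Proof.
(* From here on the slope at 0 enters only through this linear bound. *)
have hd t : 0 <= t <= 1 -> phi t <= d * t.
  exact: concave01_le_slope0 hder.
have d0 : 0 < d by have := hd 1; rewrite h1; lra.
have hK X : MarcSpace phi X ->
    (LorentzNorm phi X <= (phi d^-1)^-1%:E * MarcNorm phi X)%E.
  exact: LorentzNorm_le_MarcNorm.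
split; first by exists (phi d^-1)^-1.
split; first exact: LorentzSpace_MarcSpace hd.
split => // Rn1 Rn2 hR1 hf1 hR2 hf2.
have [K12 K12_gt0 le12] := ri_norm_dominated Rn1 Rn2 phi d d0 hd hR1 hf1 hR2.
have [K21 K21_gt0 le21] := ri_norm_dominated Rn2 Rn1 phi d d0 hd hR2 hf2 hR1.
have lty (K : R) (x y : \bar R) : 0 < K ->
    (x <= K%:E * y -> y < +oo -> x < +oo)%E.
  move=> K0 xy yoo; apply: le_lt_trans xy _.
  by rewrite lte_mul_pinfty// lee_fin ltW.
split.
  move=> X mX; split => [n1|n2].
    exact: lty K21_gt0 (le21 X mX) n1.
  exact: lty K12_gt0 (le12 X mX) n2.
(* The lower constant is the inverse of the one that bounds the first norm by the second. *)
exists K12^-1, K21; split; first by rewrite invr_gt0.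
split => // X mX _; split; last exact: le21.
by rewrite lee_pdivrMl//; exact: le12.
Qed.
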